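(* Let $M>m>0$ be real numbers, let $\mathcal{H}$ be a complex Hilbert space and let $A\in\mathcal{B}(\mathcal{H})$. If $C_{M,m}(A)$ is accretive, then $$\frac{2Mm}{(M+m)^2}\,\big\|\,|A|^2+|A^*|^2\,\big\|\le \omega^2(A).$$
   Context: $\mathcal{B}(\mathcal{H})$ is the algebra of bounded linear operators on $\mathcal{H}$, with identity $I$ and operator norm $\|\cdot\|$. $C_{M,m}(T)=(MI-T^* )(T-mI)$; $|T|=(T^*T)^{1/2}$. $T$ is accretive if $\mathfrak{R}T=\frac{T+T^*}{2}$ is positive semi-definite. The numerical radius is $\omega(T)=\sup\{|\langle Tx,x\rangle|: x\in\mathcal{H},\ \|x\|=1\}$, and $\omega^2(T)=(\omega(T))^2$. *)

(* Defs.v *)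
From HB Require Import structures.
From mathcomp Require Import all_boot all_order all_algebra sesquilinear.
From mathcomp Require Import complex.
From mathcomp Require Import boolp classical_sets functions reals topology
  normedtype.

Set Implicit Arguments.
Unset Strict Implicit.
Unset Printing Implicit Defensive.
Import Order.TTheory GRing.Theory Num.Theory Num.Def numFieldNormedType.Exports.

Local Open Scope classical_set_scope.
Local Open Scope ring_scope.
Local Open Scope complex_scope.

(* In R[i], 0 <= z means that z is real and nonnegative. Norms of vectors and
   moduli of scalars are valued in R[i].

   The inner product is linear in its first argument, conjugate-linear in its
   second one, and induces the complete norm of H. *)
HB.mixin Record CompleteNormedModule_isHilbert (R : realType) H
    of CompleteNormedModule R[i] H := {
  inner : {dot H for (@conjC R[i])} ;
  inner_norm : forall x : H, `|x| ^+ 2 = inner x x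
}.

#[short(type="hilbertType")]
HB.structure Definition Hilbert (R : realType) :=
  { H of CompleteNormedModule R[i] H & CompleteNormedModule_isHilbert R H }.

Section BoundedOperators.
Variables (R : realType) (H : hilbertType R).

Definition bounded_linear (f : H -> H) : Prop :=
  linear f /\ exists C : R, forall x : H, `|f x| <= C%:C * `|x|.

Definition bounded_linear_pred : {pred H -> H} := fun f => `[< bounded_linear f >].

Record bop := Bop { bop_fun :> H -> H; bop_funP : bop_fun \in bounded_linear_pred }.

HB.instance Definition _ := [isSub for bop_fun].
HB.instance Definition _ := [Choice of bop by <:].

Lemma bounded_linearP (f : H -> H) :
  reflect (bounded_linear f) (f \in bounded_linear_pred).
Proof. exact: asboolP. Qed.

Lemma bounded_linear_submod : submod_closed bounded_linear_pred.
Proof.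
split.
  apply/bounded_linearP; split; first by move=> a x y; rewrite scaler0 addr0.
  by exists 0 => x; rewrite mul0r normr0.
move=> a f g /bounded_linearP[lf [C hC]] /bounded_linearP[lg [D hD]].
apply/bounded_linearP; split.
  move=> b x y; rewrite !fctE lf lg !scalerDr !scalerA [a * b]mulrC.
  by rewrite -!addrA; congr (_ + _); rewrite addrCA.
exists (complex.Re `|a| * C + D) => x.
have -> : (complex.Re `|a| * C + D)%:C = `|a| * C%:C + D%:C.
  by rewrite raddfD /= rmorphM /=; congr (_ * _ + _).
rewrite mulrDl.
rewrite !fctE (le_trans (ler_normD _ _)) // lerD //.
by rewrite normrZ -mulrA ler_wpM2l.
Qed.

HB.instance Definition _ := GRing.isSubmodClosed.Build R[i] (H -> H)
  bounded_linear_pred bounded_linear_submod.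
HB.instance Definition _ := [SubChoice_isSubLmodule of bop by <:].

Lemma bop_linear (A : bop) : linear A.
Proof. by case: A => f /= /bounded_linearP[]. Qed.

Lemma id_bounded_linear : (id : H -> H) \in bounded_linear_pred.
Proof. by apply/bounded_linearP; split=> //; exists 1 => x; rewrite mul1r. Qed.

Lemma comp_bounded_linear (A B : bop) : A \o B \in bounded_linear_pred.
Proof.
case: A B => [f /= /bounded_linearP[lf [C hC]]] [g /= /bounded_linearP[lg [D hD]]].
apply/bounded_linearP; split; first by move=> a x y /=; rewrite lg lf.
exists (`|C| * D) => x /=; rewrite rmorphM /= -mulrA.
apply: le_trans (hC _) _; apply: (@le_trans _ _ (`|C|%:C * `|g x|)).
  by rewrite ler_wpM2r // lecR ler_norm.
by rewrite ler_wpM2l // lecR.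
Qed.

Definition bop1 : bop := Bop id_bounded_linear.
Definition bop_mul (A B : bop) : bop := Bop (comp_bounded_linear A B).

Lemma bopP (A B : bop) : A =1 B -> A = B.
Proof. by move=> AB; apply: val_inj; apply/funext. Qed.

Lemma bop_mulA : associative bop_mul.
Proof. by move=> A B C; exact: bopP. Qed.
Lemma bop_mul1l : left_id bop1 bop_mul.
Proof. by move=> A; exact: bopP. Qed.
Lemma bop_mul1r : right_id bop1 bop_mul.
Proof. by move=> A; exact: bopP. Qed.
Lemma bop_mulDl : left_distributive bop_mul +%R.
Proof. by move=> A B C; exact: bopP. Qed.
Lemma bop_mulDr : right_distributive bop_mul +%R.
Proof.
move=> A B C; apply: bopP => x /=.
by have := bop_linear A 1 (B x) (C x); rewrite !scale1r.
Qed.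

(* The product of the algebra B(H) is composition, its unit the identity. B(H)
   is not required to be nontrivial, because H may be {0}. *)
HB.instance Definition _ := GRing.Zmodule_isPzRing.Build bop
  bop_mulA bop_mul1l bop_mul1r bop_mulDl bop_mulDr.

Implicit Types A T P : bop.

(* The Hilbert space adjoint, which exists and is unique by the Riesz
   representation theorem. *)
Definition adjoint T : bop :=
  xget 0 [set S : bop | forall x y : H, inner (T x) y = inner x (S y)].

Definition possemidef T : Prop := forall x : H, 0 <= inner (T x) x.

(* The positive square root, which exists and is unique when T is positive
   semi-definite. *)
Definition opsqrt T : bop :=
  xget 0 [set P : bop | possemidef P /\ P * P = T].

Definition opabs T : bop := opsqrt (adjoint T * T).

Definition opRe T : bop := 2^-1 *: (T + adjoint T).

Definition accretive T : Prop := possemidef (opRe T).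

(* complex.Re only turns the norms, which are valued in R[i], into elements of
   R. *)
Definition opnorm T : R :=
  sup [set complex.Re `|T x| | x in [set x : H | `|x| <= 1]].

(* If H = {0}, the set is empty and its supremum is 0. *)
Definition numradius T : R :=
  sup [set complex.Re `|inner (T x) x| | x in [set x : H | `|x| = 1]].

Definition Cop (M m : R) T : bop :=
  (M%:C *: (1 : bop) - adjoint T) * (T - m%:C *: (1 : bop)).

End BoundedOperators.

(* Main.v *)
Require Import Defs.
From mathcomp Require Import all_boot all_order all_algebra.
From mathcomp Require Import reals.
From mathcomp Require Import sesquilinear complex boolp classical_sets.
From mathcomp Require Import normedtype.
From mathcomp Require Import ring lra.

Import Order.TTheory GRing.Theory Num.Theory.

Local Open Scope ring_scope.

(** Everything takes place in the real inner product Re <x, y>. There the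
    accretivity of (M - A^* )(A - m) reads
      |A x|^2 <= (M + m) Re <A x, x> - M m |x|^2,
    and by completing the square this says that A lies in an operator-norm
    disc: |A x - c x| <= r |x| with c = (M + m) / 2 and r = (M - m) / 2. An
    operator and its adjoint have the same norm ([adjoint_bound]), so A^* - c
    obeys the same bound and A^* satisfies the same quadratic inequality, with
    the same Re <A x, x> = Re <A^* x, x> ([adjoint_Cop_rinner]). Adding the two,
      <(A^* A + A A^* ) x, x> <= 2 (M + m) Re <A x, x> - 2 M m |x|^2.
    As Re <A x, x> <= w |x|^2 for the numerical radius w, the inequality
    2 s w p <= s^2 w^2 + p^2, with s = M + m and p = 2 M m, bounds the right
    side by (s^2 w^2 / p) |x|^2. A symmetric positive operator whose quadratic
    form is at most K |x|^2 has norm at most K ([opnorm_le]), which is the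
    claim.

    The adjoint and the square root are defined by choice with default 0. The
    argument above only uses that the quadratic form of |T|^2 lies between 0 and
    that of T^* T, and this also holds when |T| takes the default value
    ([opabs_sqr_form]). If A^* takes the default value, then
    |A|^2 = |A^*|^2 = 0 and the left side vanishes. *)

(** * The real inner product *)

Section RealInnerProduct.
Set Implicit Arguments.
Unset Strict Implicit.
Context {R : realType} {H : hilbertType R}.
Implicit Types (x y z : H) (c t : R).

Lemma innerC x y : inner x y = ((inner y x)^*)%C.
Proof. by rewrite (hermC inner) expr0 mul1r. Qed.

Lemma innerBl x y z : inner (x - y) z = inner x z - inner y z.
Proof. exact: linearBl. Qed.

Lemma innerBr x y z : inner x (y - z) = inner x y - inner x z.
Proof. exact: linearBr. Qed.

Lemma innerZlr c x y : inner (c%:C%C *: x) y = inner x (c%:C%C *: y).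
Proof.
rewrite [LHS]linearZl_LR [RHS]linearZr_LR /=; congr (_ * _).
by rewrite conj_Creal // complex_real.
Qed.

Definition rinner x y : R := complex.Re (inner x y).

Lemma rinnerC x y : rinner x y = rinner y x.
Proof. by rewrite /rinner innerC; case: (inner y x). Qed.

Lemma rinnerDl x y z : rinner (x + y) z = rinner x z + rinner y z.
Proof. by rewrite /rinner linearDl raddfD. Qed.

Lemma rinnerDr x y z : rinner z (x + y) = rinner z x + rinner z y.
Proof. by rewrite !(rinnerC z) rinnerDl. Qed.

Lemma rinnerZl c x y : rinner (c%:C%C *: x) y = c * rinner x y.
Proof.
rewrite /rinner linearZl_LR /=; case: (inner x y) => a b /=.
by rewrite mul0r subr0.
Qed.

Lemma rinnerZr c x y : rinner x (c%:C%C *: y) = c * rinner x y.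
Proof. by rewrite !(rinnerC x) rinnerZl. Qed.

Lemma rinner0l x : rinner 0 x = 0.
Proof. by have := rinnerDl 0 0 x; rewrite addr0; lra. Qed.

Lemma rinner0r x : rinner x 0 = 0.
Proof. by rewrite rinnerC rinner0l. Qed.

Lemma rinnerNl x y : rinner (- x) y = - rinner x y.
Proof. by rewrite /rinner linearNl raddfN. Qed.

Lemma rinnerNr x y : rinner x (- y) = - rinner x y.
Proof. by rewrite !(rinnerC x) rinnerNl. Qed.

Definition rinnerE :=
  (rinnerDl, rinnerDr, rinnerNl, rinnerNr, rinnerZl, rinnerZr).

Lemma normE x : `|x| = (complex.Re `|x|)%:C%C.
Proof. by rewrite RRe_real // realE normr_ge0. Qed.

Lemma Re_norm_ge0 x : 0 <= complex.Re `|x|.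
Proof. by rewrite -lecR -normE; exact: normr_ge0. Qed.

Lemma rinnerxx x : rinner x x = complex.Re `|x| ^+ 2.
Proof. by rewrite /rinner -inner_norm normE -rmorphXn. Qed.

Lemma rinnerxx_ge0 x : 0 <= rinner x x.
Proof. by rewrite rinnerxx sqr_ge0. Qed.

Lemma rinner_le x y : `|rinner x y| <= rinner x x + rinner y y.
Proof.
have := rinnerxx_ge0 (x + y); have := rinnerxx_ge0 (x - y).
rewrite !rinnerE (rinnerC y x) ler_norml => ? ?.
have := rinnerxx_ge0 x; have := rinnerxx_ge0 y.
by move=> ? ?; apply/andP; split; lra.
Qed.

(** A crude substitute for the Cauchy-Schwarz inequality: it serves only to
    make the set that defines the numerical radius bounded. *)
Lemma Re_inner_norm_le x y :
  complex.Re `|inner x y| <= 2 * (rinner x x + rinner y y).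
Proof.
(* The imaginary part is, up to sign, the real inner product with 'i x. *)
have Im_le : `|complex.Im (inner x y)| <= rinner x x + rinner y y.
  have -> : complex.Im (inner x y) = - rinner ('i%C *: x) y.
    by rewrite /rinner linearZl_LR /=; case: (inner x y) => a b /=; ring.
  rewrite normrN (le_trans (rinner_le _ _)) // lerD2r !rinnerxx normrZ.
  by rewrite normc_def /= expr0n add0r expr1n sqrtr1 mul1r.
have Re_le := rinner_le x y.
set K := _ + _ in Im_le Re_le *.
have K0 : 0 <= K by rewrite addr_ge0 ?rinnerxx_ge0.
rewrite normc_def /= -[leRHS]ger0_norm; last by rewrite mulr_ge0.
rewrite -sqrtr_sqr ler_wsqrtr // -[X in X + _]real_normK ?num_real //.
rewrite -[X in _ + X]real_normK ?num_real // exprMn.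
have := normr_ge0 (complex.Re (inner x y)).
have := normr_ge0 (complex.Im (inner x y)).
by move: Im_le Re_le; rewrite /rinner; nra.
Qed.

End RealInnerProduct.

(** * Adjoint pairs of operators *)

Section Operators.
Set Implicit Arguments.
Unset Strict Implicit.
Context {R : realType} {H : hilbertType R}.
Implicit Types (A B S T : bop H) (x y : H).

Lemma bopB T x y : T (x - y) = T x - T y.
Proof.
have := bop_linear T (-1) y x; rewrite !scaleN1r => TB.
by rewrite addrC TB addrC.
Qed.

Lemma bopZ T a x : T (a *: x) = a *: T x.
Proof.
have T0 : T 0 = 0 by rewrite -(subrr 0) bopB !subrr.
by have := bop_linear T a x 0; rewrite T0 !addr0.
Qed.

(** A relation rather than the function [adjoint]: an adjoint of a difference or
    a product is exhibited by a formula, and [adjointP] then applies to it. *)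
Definition is_adjoint T S : Prop := forall x y, inner (T x) y = inner x (S y).

Lemma is_adjoint_rinner T S x y :
  is_adjoint T S -> rinner (T x) y = rinner x (S y).
Proof. by move=> TS; rewrite /rinner TS. Qed.

Lemma is_adjoint_sym T S : is_adjoint T S -> is_adjoint S T.
Proof. by move=> TS x y; rewrite innerC -TS -innerC. Qed.

Lemma is_adjointM T T' S S' :
  is_adjoint T T' -> is_adjoint S S' -> is_adjoint (T * S) (S' * T').
Proof. by move=> TT' SS' x y; rewrite -[LHS]/(inner (T (S x)) y) TT' SS'. Qed.

Lemma is_adjointB T T' S S' :
  is_adjoint T T' -> is_adjoint S S' -> is_adjoint (T - S) (T' - S').
Proof.
move=> TT' SS' x y; rewrite -[LHS]/(inner (T x - S x) y).
by rewrite innerBl TT' SS' -innerBr.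
Qed.

Lemma is_adjoint_scalar (c : R) :
  is_adjoint (c%:C%C *: (1 : bop H)) (c%:C%C *: (1 : bop H)).
Proof. by move=> x y; apply: innerZlr. Qed.

Lemma adjointP T S : is_adjoint T S -> is_adjoint T (adjoint T).
Proof.
move=> TS; rewrite /adjoint; case: xgetP => [S' _ //|/(_ S) NS].
by case: NS.
Qed.

Lemma accretive_rinner T S x :
  is_adjoint T S -> accretive T -> 0 <= rinner (T x) x.
Proof.
move=> /adjointP TT' /(_ x); rewrite lecE => /andP[_ /=].
rewrite -/(rinner _ x) -[X in rinner X x]/(2^-1 *: (T x + adjoint T x)).
have -> : 2^-1 = (2^-1 : R)%:C%C :> R[i] by rewrite fmorphV rmorph_nat.
rewrite !rinnerE [rinner (adjoint T x) x]rinnerC -(is_adjoint_rinner _ _ TT').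
by lra.
Qed.

(** The classical proof that an operator and its adjoint have the same norm
    factors |B' x|^2 = <B B' x, x> by Cauchy-Schwarz; expanding
    0 <= |B B' x - r^2 x|^2 gives the bound directly, since the cross term is
    2 r^2 |B' x|^2 and |B B' x|^2 <= r^2 |B' x|^2. *)
Lemma adjoint_bound B B' (r : R) : 0 < r -> is_adjoint B B' ->
  (forall x, rinner (B x) (B x) <= r ^+ 2 * rinner x x) ->
  forall x, rinner (B' x) (B' x) <= r ^+ 2 * rinner x x.
Proof.
move=> r0 BB' Br x; have r2 : 0 < r ^+ 2 by rewrite exprn_gt0.
have := rinnerxx_ge0 (B (B' x) - (r ^+ 2)%:C%C *: x).
rewrite !rinnerE (rinnerC x) (is_adjoint_rinner _ x BB') => sq_ge0.
have Br' := Br (B' x).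
by rewrite -(ler_pM2l r2); lra.
Qed.

(** * Numerical radius and operator norm *)

Lemma has_ubound_numradius A :
  has_ubound
    [set complex.Re `|inner (A x) x| | x in [set x : H | `|x| = 1]]%classic.
Proof.
have /bounded_linearP[_ [C AC]] := bop_funP A.
exists (2 * (C ^+ 2 + 1)) => _ [x /= x1 <-].
apply: le_trans (Re_inner_norm_le _ _) _.
rewrite ler_pM2l // !rinnerxx x1 expr1n lerD2r.
have := AC x; rewrite x1 mulr1 normE lecR.
by have := Re_norm_ge0 (A x); nra.
Qed.

Lemma rinner_le_numradius A x : rinner (A x) x <= numradius A * rinner x x.
Proof.
have [->|x0] := eqVneq x 0.
  by rewrite !rinner0r mulr0.
set n := complex.Re `|x|; have n0 : 0 < n by rewrite -ltcR -normE normr_gt0.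
pose y := (n^-1)%:C%C *: x.
have y1 : `|y| = 1.
  rewrite normrZ (normE x) -/n ger0_norm ?lecR ?invr_ge0 ?(ltW n0) //.
  by rewrite -rmorphM mulVf ?gt_eqF.
have : rinner (A y) y <= numradius A.
  apply: le_trans (_ : complex.Re `|inner (A y) y| <= _).
    rewrite -lecR RRe_real ?normr_real //.
    by rewrite (le_trans _ (normc_ge_Re _)) // lecR ler_norm.
  by apply: (ub_le_sup (has_ubound_numradius A)); exists y.
rewrite /y bopZ !rinnerE mulrA -expr2 exprVn rinnerxx -/n.
by rewrite mulrC ler_pdivrMr ?exprn_gt0.
Qed.

(** With 0 <= <S y, y> at y = K x - S x and the upper bound at x and at S x,
      0 <= K^2 <S x, x> - 2 K |S x|^2 + <S S x, S x>
        <= K^3 |x|^2 - K |S x|^2. *)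
Lemma opnorm_le S (K : R) : 0 <= K ->
  (forall x y, rinner (S x) y = rinner x (S y)) ->
  (forall x, 0 <= rinner (S x) x <= K * rinner x x) -> opnorm S <= K.
Proof.
move=> K0 Ssym SK.
have SKsq x : rinner (S x) (S x) <= K ^+ 2 * rinner x x.
  have form_ge0 t : 0 <= t ^+ 2 * rinner (S x) x - 2 * t * rinner (S x) (S x)
                         + rinner (S (S x)) (S x).
    have /andP[+ _] := SK (t%:C%C *: x - S x).
    rewrite bopB bopZ !rinnerE (Ssym (S x) x); lra.
  have /andP[_ Sx] := SK x; have /andP[_ SSx] := SK (S x).
  have [K0'|Kn0] := eqVneq K 0.
    (* Division by K is impossible here; y = x - S x gives S x = 0. *)
    by have := form_ge0 1; rewrite K0' in Sx SSx *; lra.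
  have Kgt0 : 0 < K by rewrite lt_def Kn0.
  have := ler_wpM2l (sqr_ge0 K) Sx; have := form_ge0 K.
  by move=> ? ?; rewrite -(ler_pM2l Kgt0); lra.
apply: ge_sup.
  exists (complex.Re `|S 0|), 0 => //=; first by rewrite normr0.
move=> _ [x /= x1 <-].
rewrite -(ler_pXn2r (ltn0Sn 1)) ?nnegrE ?Re_norm_ge0 // -rinnerxx.
apply: le_trans (SKsq x) _; rewrite rinnerxx ler_piMr ?sqr_ge0 //.
by rewrite expr_le1 ?Re_norm_ge0 // -lecR -normE.
Qed.

(** * The squares of the absolute values *)

Lemma opsqrt_sqr T : opsqrt T ^+ 2 = T \/ opsqrt T ^+ 2 = 0.
Proof.
rewrite /opsqrt expr2; case: xgetP => [P _ [_ ->]|_]; first by left.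
by right; rewrite mul0r.
Qed.

(** |T|^2 is T^* T or the default 0. Both are symmetric, with a quadratic
    form between 0 and |T x|^2. *)
Lemma opabs_sqr_form T : is_adjoint T (adjoint T) ->
  (forall x y, rinner ((opabs T ^+ 2) x) y = rinner x ((opabs T ^+ 2) y)) /\
  (forall x, 0 <= rinner ((opabs T ^+ 2) x) x <= rinner (T x) (T x)).
Proof.
move=> TT'; have T'T := is_adjoint_sym TT'.
have [-> | ->] := opsqrt_sqr (adjoint T * T); split=> [x y|x].
- rewrite -[X in rinner X]/(adjoint T (T x)) -[(_ * T) y]/(adjoint T (T y)).
  by rewrite (is_adjoint_rinner _ _ T'T) (is_adjoint_rinner _ _ TT').
- rewrite -[X in rinner X]/(adjoint T (T x)) (is_adjoint_rinner _ _ T'T).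
  by rewrite rinnerxx_ge0 lexx.
- rewrite -[(0 : bop H) x]/(0 : H) -[(0 : bop H) y]/(0 : H).
  by rewrite rinner0l rinner0r.
- rewrite -[(0 : bop H) x]/(0 : H).
  by rewrite rinner0l lexx rinnerxx_ge0.
Qed.

(** * Accretivity of the Cop transform as a disc condition *)

(** Re <(M - A^* ) u, x> = M Re <u, x> - Re <u, A x> with u = A x - m x. *)
Lemma accretive_Cop_rinner (M m : R) A :
  is_adjoint A (adjoint A) -> accretive (Cop M m A) -> forall x,
  rinner (A x) (A x) <= (M + m) * rinner (A x) x - M * m * rinner x x.
Proof.
move=> AA' Cacc x; have A'A := is_adjoint_sym AA'.
have Cadj : is_adjoint (Cop M m A)
    ((adjoint A - m%:C%C *: (1 : bop H)) * (M%:C%C *: (1 : bop H) - A)).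
  by apply: is_adjointM; apply: is_adjointB => //; apply: is_adjoint_scalar.
have := accretive_rinner x Cadj Cacc.
set u := A x - m%:C%C *: x.
rewrite -[X in rinner X x]/(M%:C%C *: u - adjoint A u).
rewrite !rinnerE (is_adjoint_rinner _ _ A'A) !rinnerE (rinnerC x (A x)).
by lra.
Qed.

(** The hypothesis and the conclusion are |(A - c) x| <= r |x| and
    |(A' - c) x| <= r |x| with both sides squared and expanded, because
    c^2 - r^2 = M m; so the bound passes from A - c to its adjoint. *)
Lemma adjoint_Cop_rinner (M m : R) A A' : m < M -> is_adjoint A A' ->
  (forall x,
    rinner (A x) (A x) <= (M + m) * rinner (A x) x - M * m * rinner x x) ->
  forall x,
    rinner (A' x) (A' x) <= (M + m) * rinner (A x) x - M * m * rinner x x.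
Proof.
move=> mM AA' Adisc x; pose c := (M + m) / 2; pose r := (M - m) / 2.
have r0 : 0 < r by rewrite divr_gt0 ?subr_gt0.
pose B := A - c%:C%C *: (1 : bop H); pose B' := A' - c%:C%C *: (1 : bop H).
have BB' : is_adjoint B B' by apply: is_adjointB => //; apply: is_adjoint_scalar.
have Br y : rinner (B y) (B y) <= r ^+ 2 * rinner y y.
  rewrite -[B y]/(A y - c%:C%C *: y) !rinnerE (rinnerC y (A y)).
  by have := Adisc y; rewrite /c /r; lra.
have := adjoint_bound r0 BB' Br x.
rewrite -[B' x]/(A' x - c%:C%C *: x) !rinnerE (rinnerC (A' x) x).
by rewrite -(is_adjoint_rinner x x AA') /c /r; lra.
Qed.

Lemma adjoint_default A : ~ is_adjoint A (adjoint A) -> adjoint A = 0.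
Proof. by rewrite {2}/adjoint; case: xgetP => // S _ /adjointP AS /(_ AS). Qed.

End Operators.

Theorem theorem3p2 (R : realType) (M m : R) (H : hilbertType R) (A : bop H) :
  0 < m -> m < M -> accretive (Cop M m A) ->
  2 * M * m / (M + m) ^+ 2 * opnorm (opabs A ^+ 2 + opabs (adjoint A) ^+ 2)
    <= numradius A ^+ 2.
Proof.
move=> m0 mM Cacc; have M0 := lt_trans m0 mM.
(* If A^* is the default 0, then A^* A and A^{**} A^* are 0 and so are the
   squares of their roots. *)
have [AA'|/adjoint_default A'0] := pselect (is_adjoint A (adjoint A)); last first.
  have abs0 (T : bop H) : adjoint T * T = 0 -> opabs T ^+ 2 = 0.
    by move=> T0; rewrite /opabs T0; case: (opsqrt_sqr (0 : bop H)).
  rewrite abs0 ?A'0 ?mul0r // abs0 ?mulr0 // addr0.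
  apply: le_trans (sqr_ge0 _); rewrite mulr_ge0_le0 //.
    by rewrite divr_ge0 ?sqr_ge0 // !mulr_ge0 // ltW.
  apply: opnorm_le => // [x y|x].
    by rewrite rinner0l rinner0r.
  by rewrite rinner0l mul0r lexx.
have A'A'' : is_adjoint (adjoint A) (adjoint (adjoint A)).
  exact: adjointP (is_adjoint_sym AA').
have Adisc := accretive_Cop_rinner AA' Cacc.
have A'disc := adjoint_Cop_rinner mM AA' Adisc.
have [sym1 form1] := opabs_sqr_form AA'.
have [sym2 form2] := opabs_sqr_form A'A''.
set w := numradius A; set a := 2 * M * m / (M + m) ^+ 2.
have a0 : 0 < a by rewrite divr_gt0 ?exprn_gt0 ?addr_gt0 // !mulr_gt0.
rewrite mulrC -ler_pdivlMr //; apply: opnorm_le.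
- by rewrite divr_ge0 ?sqr_ge0 // ltW.
- by move=> x y; rewrite !rinnerDl !rinnerDr sym1 sym2.
- move=> x; rewrite rinnerDl.
  have /andP[? ?] := form1 x; have /andP[? ?] := form2 x.
  rewrite addr_ge0 //=.
  apply: le_trans (_ : 2 * (M + m) * rinner (A x) x - 2 * M * m * rinner x x <= _).
    by have := Adisc x; have := A'disc x; lra.
  have -> : w ^+ 2 / a = w ^+ 2 * (M + m) ^+ 2 / (2 * M * m).
    by rewrite /a; field; rewrite !gt_eqF ?addr_gt0.
  have Mm0 : 0 < 2 * M * m by rewrite !mulr_gt0.
  rewrite [leRHS]mulrAC ler_pdivlMr //.
  (* 2 s w p <= s^2 w^2 + p^2 for s = M + m and p = 2 M m, times |x|^2. *)
  have amgm := mulr_ge0 (rinnerxx_ge0 x) (sqr_ge0 ((M + m) * w - 2 * M * m)).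
  have := rinner_le_numradius A x.
  rewrite -(ler_pM2l (mulr_gt0 (addr_gt0 M0 m0) Mm0)) -/w.
  by lra.
Qed.
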